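(* Let $K$ be a finite simplicial complex and let $f_1,f_2:K\to\mathbb{R}$ be discrete Morse functions. Then $f_1$ and $f_2$ can be transformed into one another by a finite sequence of birth-death transitions: there exist an integer $m\ge 0$ and discrete Morse functions $\phi_0,\phi_1,\dots,\phi_m:K\to\mathbb{R}$ such that $\phi_0$ is equivalent to $f_1$, $\phi_m$ is equivalent to $f_2$, and for each $j=1,\dots,m$ the connectedness homomorphism $C_*^{\phi_{j-1}}\to C_*^{\phi_j}$ is a birth transition or a death transition.
   Context: Let $K$ be a finite simplicial complex (nonempty simplices), each simplex oriented; $K_p$ is the set of $p$-simplices; $\alpha\prec\sigma$ means $\alpha$ is a face of $\sigma$; $[\sigma:\alpha]=\pm1$ is the incidence number of a simplex $\sigma$ and a codimension-one face $\alpha$. A discrete Morse function is a map $f:K\to\mathbb{R}$ such that for every $p$ and every $\sigma\in K_p$: $\#\{\tau\in K_{p+1}:\tau\succ\sigma,\ f(\tau)\le f(\sigma)\}\le 1$ and $\#\{v\in K_{p-1}: v\prec\sigma,\ f(\sigma)\le f(v)\}\le 1$. The simplex $\sigma$ is critical if both numbers are $0$; $Cr_q(f)$ is the set of critical $q$-simplices. The gradient vector field $V$ of $f$ is the set of pairs $(\alpha,\beta)$ with $\alpha\prec\beta$, $\dim\beta=\dim\alpha+1$, $f(\alpha)\ge f(\beta)$. Two discrete Morse functions are equivalent if their gradient vector fields coincide. Gradient paths and coefficients (with $V$ the gradient vector field of $f$): (a) For a critical $q$-simplex $\sigma$ ($q\ge1$) and a $q$-simplex $\sigma'$, a path from $\sigma$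 to $\sigma'$ is a sequence $\sigma=\beta_0,\alpha_1,\beta_1,\dots,\alpha_r,\beta_r=\sigma'$ ($r\ge0$) with $\beta_{j-1}\succ\alpha_j$, $(\alpha_j,\beta_j)\in V$ for $1\le j\le r$, and $\alpha_{j+1}\ne\alpha_j$; its weight is $m=\prod_{j=1}^r\big(-[\beta_{j-1}:\alpha_j][\beta_j:\alpha_j]\big)$. (b) For vertices $v,w$, a path from $v$ to $w$ is a sequence $v=\alpha_0,\beta_0,\alpha_1,\dots,\beta_{r-1},\alpha_r=w$ ($r\ge 0$) with $(\alpha_j,\beta_j)\in V$, $\beta_j\succ\alpha_{j+1}\ne\alpha_j$; its weight is $m=\prod_{j=0}^{r-1}\big(-[\beta_j:\alpha_j][\beta_j:\alpha_{j+1}]\big)$. (c) For a critical $q$-simplex $\sigma$ and a $(q-1)$-simplex $\alpha$, a path from $\sigma$ to $\alpha$ is a path as in (a) from $\sigma$ to some $\beta_r$ followed by a face $\alpha\prec\beta_r$ of codimension one, with $\alpha\neq\alpha_r$ if $r\ge1$; its weight is the weight in (a) times $[\beta_r:\alpha]$. In each case $n^f(\cdot,\cdot)$ denotes the sum of the weights of all such paths (trivial paths have weight $1$). The discrete Morse complex $(C_*^f,\partial^f)$ has $C_q^f$ free abelian on $Cr_q(f)$ and $\partial_q^f(\sigma)=\sum_{\alpha\in Cr_{q-1}(f)}n^f(\sigma,\alpha)\alpha$, $\partial_0^f=0$. For discrete Morse functions $f,f'$ on $K$, the connectedness homomorphism $C_*^{f}\to C_*^{f'}$ is the family of homomorphisms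 $C_q^{f}\to C_q^{f'}$ given on $\sigma\in Cr_q(f)$ by $\sigma\mapsto\sum_{\tau\in Cr_q(f')}n^{f}(\sigma,\tau)\tau$ if $q\ge1$, and by $\sigma\mapsto\sum_{\tau\in Cr_0(f')}n^{f'}(\sigma,\tau)\tau$ if $q=0$. Birth/death transitions: suppose that for some $i\ge1$ one has $\#Cr_i(f)=\#Cr_i(f')-1$, $\#Cr_{i-1}(f)=\#Cr_{i-1}(f')-1$, $Cr_q(f)=Cr_q(f')$ for all $q\ne i,i-1$, and that $f'$ has exactly two additional critical simplices, i.e. $Cr_i(f')=Cr_i(f)\sqcup\{\tilde\sigma\}$ and $Cr_{i-1}(f')=Cr_{i-1}(f)\sqcup\{\tilde\alpha\}$, with $n^{f'}(\tilde\sigma,\tilde\alpha)=k\in\mathbb{Z}$. Then the connectedness homomorphism $C_*^{f}\to C_*^{f'}$ is called a birth transition and the connectedness homomorphism $C_*^{f'}\to C_*^{f}$ is called a death transition. *)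

(* Defs.v *)
From HB Require Import structures.
From mathcomp Require Import all_boot all_order all_algebra.
From mathcomp Require Import classical_sets fsbigop reals.
Set Implicit Arguments.
Unset Strict Implicit.
Unset Printing Implicit Defensive.
Import Order.TTheory GRing.Theory Num.Theory.
Local Open Scope ring_scope.

Record complex (T : finType) := Complex {
  faces :> {set {set T}};
  _ : finset.set0 \notin faces;
  _ : forall s t : {set T}, s \in faces -> t \subset s -> t != finset.set0 -> t \in faces
}.

Definition simplex (T : finType) (K : complex T) := {s : {set T} | s \in faces K}.

Section Complex.
Variables (T : finType) (K : complex T).
Implicit Types s t a b v w : simplex K.

Definition dim s : nat := #|val s|.-1.

(* An orientation of a simplex is a class of orderings of its vertices modulo
   even permutations; it is given here by a representative ordering.  The
   incidence numbers below depend only on the classes. *)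
Record orientation := Orientation {
  vlist :> simplex K -> seq T;
  _ : forall s, uniq (vlist s);
  _ : forall s, vlist s =i val s
}.

Definition facet a s : bool := (val a \subset val s) && (dim s == (dim a).+1).

(* The parity of [inversions r r'] is that of the permutation taking the
   ordering r to the ordering r' of the same vertices. *)
Definition inversions (r r' : seq T) : nat :=
  (\sum_(x <- r) \sum_(y <- r)
    ((index x r < index y r) && (index y r' < index x r')))%N.

(* If s is oriented by (v_0, ..., v_p) and a omits v_i, then [s : a] is (-1)^i
   times the sign comparing (v_0, ..., v_(i-1), v_(i+1), ..., v_p) with the
   orientation of a. *)
Definition incidence (o : orientation) s a : int :=
  if facet a s then
    (-1) ^+ (find (fun x => x \notin val a) (o s)
             + inversions [seq x <- o s | x \in val a] (o a))
  else 0.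

Section Morse.
Variable R : realType.
Implicit Types f g : simplex K -> R.

Definition low_cofacets f s : {set simplex K} :=
  [set t | facet s t & f t <= f s].

Definition high_facets f s : {set simplex K} :=
  [set v | facet v s & f s <= f v].

Definition discrete_morse f : Prop :=
  forall s, (#|low_cofacets f s| <= 1)%N /\ (#|high_facets f s| <= 1)%N.

Definition Cr f (q : nat) : {set simplex K} :=
  [set s | [&& dim s == q, #|low_cofacets f s| == 0%N
             & #|high_facets f s| == 0%N]].

Definition gradient f : {set simplex K * simplex K} :=
  [set x | facet x.1 x.2 & f x.2 <= f x.1].

Definition morse_equiv f g : Prop := gradient f = gradient g.

Section Paths.
Variables (o : orientation) (f : simplex K -> R).
Implicit Types p : seq (simplex K * simplex K).

(* A gradient path s = b_0, a_1, b_1, ..., a_r, b_r descending from a critical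
   simplex s is recorded as p = [:: (a_1, b_1); ...; (a_r, b_r)]. *)
Definition down_step (x y : simplex K * simplex K) : bool :=
  facet y.1 x.2 && (y.1 != x.1).

Definition path_from s p : bool :=
  all (fun x => x \in gradient f) p &&
  (if p is x :: p' then facet x.1 s && path down_step x p' else true).

Definition path_end s p : simplex K := last s [seq x.2 | x <- p].

Fixpoint path_weight s p : int :=
  if p is x :: p' then
    - (incidence o s x.1 * incidence o x.2 x.1) * path_weight x.2 p'
  else 1.

Definition path_to_facet s p a : bool :=
  [&& path_from s p, facet a (path_end s p)
    & (if p is x :: p' then a != (last x p').1 else true)].

(* A gradient path between vertices v = a_0, b_0, a_1, ..., b_(r-1), a_r is
   recorded as p = [:: (b_0, a_1); ...; (b_(r-1), a_r)]. *)
Fixpoint vertex_path v p w : bool :=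
  if p is x :: p' then
    [&& (v, x.1) \in gradient f, facet x.2 x.1, x.2 != v & vertex_path x.2 p' w]
  else v == w.

Fixpoint vertex_weight v p : int :=
  if p is x :: p' then
    - (incidence o x.1 v * incidence o x.1 x.2) * vertex_weight x.2 p'
  else 1.

(* The sums below run over all paths.  When f is a discrete Morse function, f
   strictly decreases along b_1, b_2, ..., resp. a_0, a_1, ..., so a path has no
   repetition there and the set of paths is finite. *)

(* Meant for s critical of dimension >= 1 and t of the same dimension. *)
Definition n_same s t : int :=
  \sum_(p \in [set p | path_from s p && (path_end s p == t)]%classic)
    path_weight s p.

(* Meant for vertices v and w. *)
Definition n_vertex v w : int :=
  \sum_(p \in [set p | vertex_path v p w]%classic) vertex_weight v p.

(* Meant for s critical and a of dimension one less. *)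
Definition n_facet s a : int :=
  \sum_(p \in [set p | path_to_facet s p a]%classic)
    path_weight s p * incidence o (path_end s p) a.

End Paths.
End Morse.
End Complex.

Section FreeExtension.
Variables (I J : finType) (c : I -> J -> int).

Definition free_ext (x : {ffun I -> int}) : {ffun J -> int} :=
  [ffun j => \sum_i x i * c i j].

Fact free_ext_is_zmod_morphism : zmod_morphism free_ext.
Proof.
move=> x y; apply/ffunP => j; rewrite !ffunE -sumrB.
by apply: eq_bigr => i _; rewrite !ffunE mulrBl.
Qed.

HB.instance Definition _ :=
  GRing.isZmodMorphism.Build {ffun I -> int} {ffun J -> int} free_ext
    free_ext_is_zmod_morphism.

End FreeExtension.

(* Boundaries out of degree 0 are zero and not recorded. *)
Record graded_group := GradedGroup {
  component :> nat -> zmodType;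
  boundary : forall q : nat, {additive component q.+1 -> component q}
}.

Section MorseComplex.
Variables (T : finType) (K : complex T) (o : orientation K) (R : realType).
Implicit Types f g : simplex K -> R.

Definition crit f (q : nat) : finType := {s : simplex K | s \in Cr f q}.

(* The free abelian group on the finite set Cr f q. *)
Definition morse_chain f (q : nat) : zmodType := {ffun crit f q -> int}.

Definition morse_boundary f (q : nat) :
    {additive morse_chain f q.+1 -> morse_chain f q} :=
  free_ext (fun (s : crit f q.+1) (a : crit f q) => n_facet o f (val s) (val a)).

Definition morse_complex f : graded_group := GradedGroup (morse_boundary f).

Definition graded_hom (C D : graded_group) :=
  forall q : nat, {additive C q -> D q}.

Definition connectedness f g : graded_hom (morse_complex f) (morse_complex g) :=
  fun q =>
    (free_ext (fun (s : crit f q) (t : crit g q) =>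
       if q is 0 then n_vertex o g (val s) (val t)
       else n_same o f (val s) (val t))
     : {additive morse_chain f q -> morse_chain g q}).

Definition one_more_pair f f' : Prop :=
  exists i : nat,
    [/\ (1 <= i)%N,
        #|Cr f i|%:Z = #|Cr f' i|%:Z - 1,
        #|Cr f i.-1|%:Z = #|Cr f' i.-1|%:Z - 1,
        (forall q : nat, q != i -> q != i.-1 -> Cr f q = Cr f' q)
      & exists (s a : simplex K) (k : int),
          [/\ s \notin Cr f i, Cr f' i = s |: Cr f i,
              a \notin Cr f i.-1, Cr f' i.-1 = a |: Cr f i.-1
            & n_facet o f' s a = k]].

Definition is_connectedness f g
    (h : graded_hom (morse_complex f) (morse_complex g)) : Prop :=
  forall q : nat, h q =1 connectedness f g q.

Definition birth_transition f g
    (h : graded_hom (morse_complex f) (morse_complex g)) : Prop :=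
  is_connectedness h /\ one_more_pair f g.

Definition death_transition f g
    (h : graded_hom (morse_complex f) (morse_complex g)) : Prop :=
  is_connectedness h /\ one_more_pair g f.

End MorseComplex.

(* Main.v *)
(** Every set W of pairs contained in the gradient of a discrete Morse function
   f is itself the gradient of a discrete Morse function, so the pairs of f1
   can be removed one at a time (births) until every simplex is critical, and
   the pairs of f2 then added one at a time (deaths).  To realise W, order the
   simplices first by dimension, counting the lower simplex of a pair in W as
   being one dimension higher, and break ties by f: comparing s with a cofacet
   t, a tie occurs only if s is matched in W and t is not a lower simplex of W,
   and then f orders s and t as W demands. *)
Require Import Defs.
From mathcomp Require Import all_boot all_order all_algebra.
From mathcomp Require Import reals zify lra.

Set Implicit Arguments.
Unset Strict Implicit.
Unset Printing Implicit Defensive.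
Import Order.TTheory GRing.Theory Num.Theory.

Section Simplices.
Local Open Scope ring_scope.
Local Notation dim := Defs.dim.
Variables (T : finType) (K : complex T).
Implicit Types a b c s t : simplex K.

Lemma simplex_card_gt0 s : (0 < #|val s|)%N.
Proof.
case: s => s sK /=; case: K sK => F F0 F1 /= sF.
by rewrite card_gt0; apply: contraNneq F0 => <-.
Qed.

(** Since [dim] is a truncated predecessor, nonemptiness of simplices is what allows dimensions to
    be replaced by cardinalities. *)
Lemma facet_card a b :
  facet a b = (val a \subset val b) && (#|val b| == #|val a|.+1).
Proof.
rewrite /facet /dim; have := simplex_card_gt0 b; have := simplex_card_gt0 a.
case: #|val a| => // m _; case: #|val b| => // n _.
Qed.

Lemma facet_dim a b : facet a b -> dim b = (dim a).+1.
Proof. by case/andP=> _ /eqP. Qed.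

(** The other intermediate simplex is [c] minus the single vertex of [b] outside [a]. It contains
    [a], so it is nonempty and belongs to the complex, and it lacks a vertex of [b]. *)
Lemma diamond a b c :
  facet a b -> facet b c -> exists b', [/\ facet a b', facet b' c & b' != b].
Proof.
rewrite !facet_card => /andP[ab /eqP cb] /andP[bc /eqP cc].
pose B := val c :\: (val b :\: val a).
have aB : val a \subset B.
  apply/subsetP => x xa; rewrite !inE xa /=.
  by rewrite (subsetP bc) // (subsetP ab).
have BK : B \in faces K.
  have := simplex_card_gt0 a; have := valP c; rewrite /B.
  case: K a b c ab cb bc cc @B aB => F F0 F1 /= a b c _ _ _ _ aB cF a0.
  apply: (F1 (val c)) => //; first exact: subsetDl.
  by rewrite -card_gt0; apply: leq_trans a0 (subset_leq_card aB).
have cD : #|val b :\: val a| = 1%N.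
  by rewrite cardsD (setIidPr ab) cb subSnn.
have cB : #|B| = #|val b|.
  rewrite cardsD (setIidPr _) ?cD ?cc ?subn1 //.
  exact: subset_trans (subsetDl _ _) bc.
exists (exist _ B BK); rewrite !facet_card /= cB cb cc cb !eqxx aB subsetDl.
split=> //; apply/eqP => eB.
have [x] : exists x, x \in val b :\: val a by apply/card_gt0P; rewrite cD.
move=> xD; have : x \in B by rewrite (congr1 val eB : B = val b); case/setDP: xD.
by rewrite /B inE xD.
Qed.

Section Morse.
Variable R : realType.
Implicit Types (f g : simplex K -> R) (W : {set simplex K * simplex K}).

Lemma gradientP f a b :
  reflect (facet a b /\ f b <= f a) ((a, b) \in gradient f).
Proof. by rewrite inE; apply: andP. Qed.

Lemma gradient_funl f a b b' : discrete_morse f ->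
  (a, b) \in gradient f -> (a, b') \in gradient f -> b = b'.
Proof.
move=> /(_ a)[/card_le1_eqP low _] ab ab'.
by apply: low; rewrite inE; move: ab ab'; rewrite !inE.
Qed.

Lemma gradient_funr f a a' b : discrete_morse f ->
  (a, b) \in gradient f -> (a', b) \in gradient f -> a = a'.
Proof.
move=> /(_ b)[_ /card_le1_eqP high] ab a'b.
by apply: high; rewrite inE; move: ab a'b; rewrite !inE.
Qed.

(** Otherwise let [b'] be the second simplex between [a] and [c]. As [a] and [c] are already paired
    with [b], neither is paired with [b'], which gives the cycle f c <= f b <= f a < f b' < f c. *)
Lemma gradient_nchain f a b c : discrete_morse f ->
  (a, b) \in gradient f -> (b, c) \notin gradient f.
Proof.
move=> mf abf; apply/negP => bcf.
have [[ab fab] [bc fbc]] := (gradientP _ _ _ abf, gradientP _ _ _ bcf).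
have [b' [ab' b'c /eqP nb]] := diamond ab bc.
have lt1 : f a < f b'.
  rewrite ltNge; apply/negP => le; apply: nb.
  by apply: gradient_funl mf _ abf; apply/gradientP.
have lt2 : f b' < f c.
  rewrite ltNge; apply/negP => le; apply: nb.
  by apply: gradient_funr mf _ bcf; apply/gradientP.
lra.
Qed.

Definition touches s (x : simplex K * simplex K) := (s == x.1) || (s == x.2).

(** If [s] is at the same end of both pairs, the Morse condition identifies them; if it is the top
    of one and the bottom of the other, [gradient_nchain] is violated. *)
Lemma gradient_matching f s x y : discrete_morse f ->
  x \in gradient f -> y \in gradient f -> touches s x -> touches s y -> x = y.
Proof.
move=> mf; case: x y => [a b] [c d] xf yf /orP[]/eqP/= e /orP[]/eqP/= e'; subst.
- by rewrite (gradient_funl mf xf yf).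
- by have := gradient_nchain b mf yf; rewrite xf.
- by have := gradient_nchain d mf xf; rewrite yf.
- by rewrite (gradient_funr mf xf yf).
Qed.

Lemma mem_Cr f q s :
  (s \in Cr f q) =
    (dim s == q) && [forall x in gradient f, ~~ touches s x].
Proof.
rewrite inE; congr (_ && _); rewrite !cards_eq0; apply/andP/forall_inP.
  move=> [/eqP/setP low /eqP/setP high] [a b] abf.
  apply/norP; split; apply/eqP => /= e; subst.
    by have := low b; move: abf; rewrite !inE /= => ->.
  by have := high a; move: abf; rewrite !inE /= => ->.
move=> nt; split; apply/eqP/setP => t; rewrite [RHS]inE; apply/negbTE/negP.
  move=> st; have /nt : (s, t) \in gradient f by move: st; rewrite !inE.
  by rewrite /touches eqxx.
move=> ts; have /nt : (t, s) \in gradient f by move: ts; rewrite !inE.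
by rewrite /touches eqxx orbT.
Qed.

(** The gradient is a matching, so the two ends of [x] lie in no other pair and become critical once
    [x] is removed; the status of every other simplex is unchanged. *)
Lemma Cr_remove_pair f g x q : discrete_morse f ->
  x \notin gradient g -> gradient f = x |: gradient g ->
  Cr g q = [set s | touches s x & dim s == q] :|: Cr f q.
Proof.
move=> mf xg ef; apply/setP => s; rewrite in_setU mem_Cr mem_Cr inE ef andbC.
case: (dim s == q); rewrite ?andbF //= !andbT; apply/forall_inP/orP.
  move=> ng; have [|nx] := boolP (touches s x); [by left | right].
  by apply/forall_inP => y /setU1P[-> //|]; apply: ng.
move=> [sx y yg|/forall_inP nf y yg]; last by apply/nf/setU1P; right.
apply: contraNN xg => sy; rewrite (gradient_matching mf _ _ sx sy) ?ef //.
  exact: setU11.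
exact: setU1r.
Qed.

(** Passing from [f] to [g] frees the pair (a, b), so the index of the transition is [dim b], which
    is at least 1. This serves births directly and deaths with the two functions exchanged. *)
Lemma one_more_pair_remove (o : orientation K) f g x : discrete_morse f ->
  x \notin gradient g -> gradient f = x |: gradient g -> one_more_pair o f g.
Proof.
case: x => a b mf xg ef; have xf : (a, b) \in gradient f by rewrite ef setU11.
have [ab _] := gradientP _ _ _ xf; have dab := facet_dim ab.
have Crg q := Cr_remove_pair q mf xg ef.
have nCr s q : touches s (a, b) -> s \notin Cr f q.
  by move=> ts; rewrite mem_Cr negb_and; apply/orP; right;
    rewrite negb_forall; apply/existsP; exists (a, b); rewrite xf ts.
have bC := nCr b (dim b) ltac:(by rewrite /touches eqxx orbT).
have aC := nCr a (dim a) ltac:(by rewrite /touches eqxx).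
have Crb : Cr g (dim b) = b |: Cr f (dim b).
  rewrite Crg; congr (_ :|: _); apply/setP => s; rewrite !inE /touches /=.
  have [-> /=|_] := eqVneq s b; first by rewrite orbT eqxx.
  by case: eqVneq => [->|//]; rewrite dab; lia.
have Cra : Cr g (dim a) = a |: Cr f (dim a).
  rewrite Crg; congr (_ :|: _); apply/setP => s; rewrite !inE /touches /=.
  have [-> /=|_] := eqVneq s a; first by rewrite eqxx.
  by case: eqVneq => [->|//]; rewrite dab; lia.
have pb : (dim b).-1 = dim a by rewrite dab.
exists (dim b); rewrite pb; split.
- by rewrite dab.
- by rewrite Crb cardsU1 bC; lia.
- by rewrite Cra cardsU1 aC; lia.
- move=> q qb qa; rewrite Crg; apply/esym/setUidPr/subsetP => s.
  rewrite inE => /andP[/orP[]/eqP-> /eqP dq]; first by rewrite -dq eqxx in qa.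
  by rewrite -dq eqxx in qb.
- by exists b, a, (n_facet o g b a).
Qed.

Section Thin.
Variables (f : simplex K -> R) (W : {set simplex K * simplex K}).

Definition raised_dim s : nat := dim s + [exists t, (s, t) \in W].

(** A real-valued encoding of the lexicographic order by [raised_dim], then [f]: the factor 1 + 2
    sum |f| strictly exceeds every difference of two values of [f], so one level of [raised_dim]
    outweighs [f]. *)
Definition thin s : R :=
  f s + (raised_dim s)%:R * (1 + 2 * \sum_t `|f t|).

Lemma dist_lt_spread s t : f s - f t < 1 + 2 * \sum_t `|f t|.
Proof.
have le u : `|f u| <= \sum_t `|f t|.
  by rewrite (bigD1 u) //= lerDl sumr_ge0.
have := le s; have := le t; rewrite !ler_norml => /andP[? ?] /andP[? ?]; lra.
Qed.

Lemma thin_lt s t : (raised_dim s < raised_dim t)%N -> thin s < thin t.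
Proof.
rewrite /thin -(ler_nat R) -natr1 => le.
have := dist_lt_spread s t.
set M : R := 1 + _ => lt; have M0 : 0 <= M.
  by rewrite addr_ge0 // mulr_ge0 // sumr_ge0.
have := ler_wpM2r M0 le; rewrite mulrDl mul1r; lra.
Qed.

Hypotheses (mf : discrete_morse f) (sWf : W \subset gradient f).

Lemma gradient_thin : gradient thin = W.
Proof.
apply/setP => -[s t]; apply/gradientP/idP => [[st]|stW]; last first.
  have stf := subsetP sWf _ stW; have [st le] := gradientP _ _ _ stf.
  split=> //; rewrite /thin /raised_dim (facet_dim st).
  have -> : [exists u, (s, u) \in W] by apply/existsP; exists t.
  (* The top [t] of a pair is not the bottom of another, so it is not raised; hence [s] and [t] tie
     and [f] decides. *)
  have -> : [exists u, (t, u) \in W] = false.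
    apply/existsP => -[u /(subsetP sWf)]; apply/negP.
    exact: gradient_nchain mf stf.
  by rewrite addn1 addn0 lerD2r.
apply: contraTT => stW; rewrite -ltNge.
have [/thin_lt //|le] := ltnP (raised_dim s) (raised_dim t).
move: (le); rewrite /raised_dim (facet_dim st).
(* Only a tie remains: [s] is raised through some pair (s, u) of W. If f t <= f s, then [t] and [u]
   are both partners of [s] in the gradient of [f], which forces (s, t) into W. *)
have [/existsP[u suW] le1|_] := boolP [exists u, (s, u) \in W]; last by lia.
have -> : thin t = f t + (raised_dim s)%:R * (1 + 2 * \sum_t `|f t|).
  congr (_ + _%:R * _); apply/eqP; rewrite eqn_leq le /raised_dim.
  by rewrite (facet_dim st) addSnnS leq_add2l (leq_trans (leq_b1 _)).
rewrite ltrD2r ltNge; apply: contra stW => ts.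
suff <- : u = t by [].
apply: gradient_funl mf (subsetP sWf _ suW) _; exact/gradientP.
Qed.

(** The Morse condition bounds numbers of gradient pairs, and a smaller gradient inherits these
    bounds. *)
Lemma discrete_morse_thin : discrete_morse thin.
Proof.
have sub x : x \in gradient thin -> x \in gradient f.
  by rewrite gradient_thin => /(subsetP sWf).
move=> s; have [low high] := mf s; split.
  apply: leq_trans low; apply/subset_leq_card/subsetP => t st.
  by have := sub (s, t); rewrite !inE /= in st *; apply.
apply: leq_trans high; apply/subset_leq_card/subsetP => t ts.
by have := sub (t, s); rewrite !inE /= in ts *; apply.
Qed.

End Thin.
End Morse.
End Simplices.

Theorem theorem4p6 (T : finType) (K : complex T) (o : orientation K)
    (R : realType) (f1 f2 : simplex K -> R) :
  discrete_morse f1 -> discrete_morse f2 ->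
  exists (m : nat) (phi : nat -> simplex K -> R),
    [/\ (forall j : nat, j <= m -> discrete_morse (phi j)),
        morse_equiv (phi 0) f1,
        morse_equiv (phi m) f2
      & forall j : nat, 1 <= j <= m ->
          birth_transition (connectedness o (phi j.-1) (phi j)) \/
          death_transition (connectedness o (phi j.-1) (phi j))].
Proof.
move=> mf1 mf2.
pose s1 := enum (gradient f1); pose s2 := enum (gradient f2).
(* Prescribed gradients: the pairs of [f1] are dropped one by one until none is left at j =
   [size s1], then those of [f2] are added. *)
pose W j := if (j <= size s1)%N then [set x in drop j s1]
            else [set x in take (j - size s1) s2].
pose phi j := thin (if (j <= size s1)%N then f1 else f2) (W j).
have sub j : W j \subset gradient (if (j <= size s1)%N then f1 else f2).
  rewrite /W; case: ifP => _; apply/subsetP => x; rewrite inE.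
    by move/mem_drop; rewrite mem_enum.
  by move/mem_take; rewrite mem_enum.
have morse j : discrete_morse (phi j).
  by apply: discrete_morse_thin => //; case: ifP.
have grad j : gradient (phi j) = W j.
  by apply: gradient_thin => //; case: ifP.
(* At k = 0 the first branch of [W] applies, but both descriptions give the empty set. *)
have W_take k : W (size s1 + k)%N = [set x in take k s2].
  rewrite /W; case: leqP => [le|_]; last by rewrite addKn.
  by have -> : k = 0%N; [lia | rewrite addn0 drop_size take0].
exists (size s1 + size s2)%N, phi; split=> // [|| j /andP[j0 jm]].
- by rewrite /morse_equiv grad /W drop0; apply/setP => x; rewrite inE mem_enum.
- rewrite /morse_equiv grad W_take take_size.
  by apply/setP => x; rewrite inE mem_enum.
case: j j0 jm => // j _ jm /=; case: (ltnP j (size s1)) => [lt|ge].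
  (* Birth: the gradient loses the entry [x] of index j in [s1]. *)
  left; split=> //; pose x := tnth (in_tuple s1) (Ordinal lt).
  have dx : drop j s1 = x :: drop j.+1 s1.
    by rewrite /x (tnth_nth x) (drop_nth x).
  have := drop_uniq j (enum_uniq (gradient f1)); rewrite dx => /andP[nx _].
  apply: (@one_more_pair_remove _ _ _ o _ _ x) => //.
    by rewrite grad /W lt inE.
  by rewrite !grad /W lt (ltnW lt) dx set_cons.
(* Death: the gradient gains the entry of index j - [size s1] in [s2], so the removal lemma is
   applied from the later function to the earlier one. *)
right; split=> //; have lt : (j - size s1 < size s2)%N by lia.
pose x := tnth (in_tuple s2) (Ordinal lt).
have dx : take (j - size s1).+1 s2 = rcons (take (j - size s1) s2) x.
  by rewrite /x (tnth_nth x) (take_nth x).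
have := take_uniq (j - size s1).+1 (enum_uniq (gradient f2)).
rewrite dx rcons_uniq => /andP[nx _].
have eW : W j = [set x in take (j - size s1) s2] by rewrite -W_take subnKC.
have eW' : W j.+1 = x |: W j.
  rewrite eW -[j.+1](subnKC (leqW ge)) W_take subSn // dx.
  by apply/setP => y; rewrite !inE mem_rcons inE.
by apply: (@one_more_pair_remove _ _ _ o _ _ x) => //; rewrite !grad ?eW' // eW inE.
Qed.
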